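(* Let $V$ be a vertex operator algebra and $W$ an irreducible ordinary $V$-module. If $W$ is $C_2$-cofinite, then $[W\otimes R]_{(E_\tau,\mathsf p,z)}$ is a finitely generated $R$-module. In particular, for any $v\in W$ there exist $s\in\mathbb N$ and $g_i(q)\in R$, $0\le i\le s-1$, such that $$L[-2]^sv+\sum_{i=0}^{s-1}g_i(q)\cdot L[-2]^iv\in\mathcal L_{E_\tau\setminus\mathsf p}(V).(W\otimes R).$$
   Context: A vertex operator algebra (VOA) is $(V,Y(\cdot,z),\mathbf 1,\omega)$, $V=\bigoplus_{n\ge0}V_n$, $\dim V_n<\infty$, with the usual axioms; $Y(a,z)=\sum a_{(n)}z^{-n-1}$, $Y(\omega,z)=\sum L(n)z^{-n-2}$, central charge $c$. An admissible module is a weak module $W=\bigoplus_{n\in\mathbb N}W(n)$ with $a_{(m)}W(n)\subseteq W(\mathrm{wt}\,a-m-1+n)$; it is ordinary of conformal weight $h_W$ if $L(0)$ is semisimple, $W(n)$ is its eigenspace of eigenvalue $h_W+n$ and $\dim W(n)<\infty$. $W$ is $C_2$-cofinite if $\dim W/C_2(W)<\infty$, $C_2(W)=\mathrm{span}\{a_{(-2)}v:a\in V,v\in W\}$. $Y_W[a,z]=Y_W(a,e^{2\pi iz}-1)e^{2\pi iz\,\mathrm{wt}\,a}=\sum a[n]z^{-n-1}$, i.e. $a[m]=(2\pi i)^{-m-1}\mathrm{Res}_zY_W(a,z)(\ln(1+z))^m(1+z)^{\mathrm{wt}\,a-1}$; $\tilde\omega=(2\pi i)^2(\omega-\frac c{24}\mathbf1)$,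 $L[n]=\tilde\omega[n+1]$. $\widetilde G_{2k}(q)=2\zeta(2k)+\frac{2(2\pi i)^{2k}}{(2k-1)!}\sum_{n\ge1}\sigma_{2k-1}(n)q^n\in\mathbb C[[q]]$ for $k\ge1$, and $R=\mathbb C[\widetilde G_2(q),\widetilde G_4(q),\widetilde G_6(q)]\subset\mathbb C[[q]]$ (which contains all $\widetilde G_{2k}(q)$). $\mathcal L_{E_\tau\setminus\mathsf p}(V).(W\otimes R)$ denotes the $R$-submodule of $W\otimes R$ (tensor over $\mathbb C$, with $a[n]$ acting $R$-linearly) generated by the elements $a[0]v$ and $a[-m]v+(-1)^m\sum_{k\ge1}\binom{2k-1}{m-1}\widetilde G_{2k}(q)a[2k-m]v$ for $a\in V$, $v\in W$, $m\ge2$. The module of coinvariants over $R$ is $[W\otimes R]_{(E_\tau,\mathsf p,z)}=(W\otimes R)/\mathcal L_{E_\tau\setminus\mathsf p}(V).(W\otimes R)$. (The notation refers to the torus $E_\tau$ with marked point $\mathsf p$ and coordinate $z$, but $q$ is a formal variable here.) *)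

(* Defs.v *)
From HB Require Import structures.
From mathcomp Require Import all_boot all_order all_algebra.
From mathcomp Require Import generic_quotient ring_quotient complex freeg.
From mathcomp Require Import boolp classical_sets functions fsbigop reals.
From mathcomp Require Import topology normedtype sequences trigo.

Set Implicit Arguments.
Unset Strict Implicit.
Unset Printing Implicit Defensive.

Import Order.TTheory GRing.Theory Num.Theory.

Local Open Scope ring_scope.
Local Open Scope quotient_scope.
Local Open Scope classical_set_scope.
Import numFieldNormedType.Exports.

Section Modules.
Variables (A : nzRingType) (M : lmodType A).
Implicit Types (S U : set M).

Definition submodule U : Prop :=
  U 0 /\ forall (a : A) x y, U x -> U y -> U (a *: x + y).

Definition lspan S : set M := smallest submodule S.

Definition fin_gen U : Prop := exists s : seq M, lspan [set` s] = U.

Lemma lspan_submodule S : submodule (lspan S).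
Proof.
split=> [U [[]]//|a x y Sx Sy U SU].
by case: (SU) => -[_ +] _; apply; [exact: Sx|exact: Sy].
Qed.

Variable S : set M.

Definition lspanb : {pred M} := fun x => `[< lspan S x >].

Lemma lspanb_closed : zmod_closed lspanb.
Proof.
have [S0 SD] := lspan_submodule S; split; first exact/asboolP.
move=> x y /asboolP Sx /asboolP Sy; apply/asboolP.
by rewrite addrC -scaleN1r; apply: SD.
Qed.
HB.instance Definition _ := GRing.isZmodClosed.Build M lspanb lspanb_closed.

(** The quotient is by the span of [S], not by [S] itself. *)
Definition quotmod := Quotient.quot lspanb.
HB.instance Definition _ := GRing.Zmodule.on quotmod.
HB.instance Definition _ := EqQuotient.on quotmod.

Definition qpi (x : M) : quotmod := \pi_quotmod x.

Lemma qpi_eq x y : qpi x = qpi y <-> lspan S (x - y).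
Proof.
split=> [/eqP|Sxy]; first by rewrite -Quotient.idealrBE => /asboolP.
by apply/eqP; rewrite -Quotient.idealrBE; apply/asboolP.
Qed.

Lemma qpiK x : qpi (repr x) = x. Proof. exact: reprK. Qed.

Lemma qpiD x y : qpi (x + y) = qpi x + qpi y.
Proof. by rewrite /qpi !piE. Qed.

Definition qscale (a : A) (x : quotmod) : quotmod := qpi (a *: repr x).

Lemma qpiZ a x : qpi (a *: x) = qscale a (qpi x).
Proof.
apply/qpi_eq; rewrite -scalerBr -[_ *: _]addr0.
have [S0 SD] := lspan_submodule S; apply: SD => //.
by apply/qpi_eq; rewrite qpiK.
Qed.

Lemma qscaleA a b x : qscale a (qscale b x) = qscale (a * b) x.
Proof. by rewrite -[x]qpiK -!qpiZ scalerA. Qed.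

Lemma qscale1 : left_id 1 qscale.
Proof. by move=> x; rewrite -[x]qpiK -!qpiZ scale1r. Qed.

Lemma qscaleDr : right_distributive qscale +%R.
Proof.
by move=> a x y; rewrite -[x]qpiK -[y]qpiK -!qpiZ -!qpiD -!qpiZ scalerDr.
Qed.

Lemma qscaleDl x : {morph qscale^~ x : a b / a + b}.
Proof. by move=> a b; rewrite -[x]qpiK -!qpiZ -!qpiD scalerDl. Qed.

HB.instance Definition _ :=
  GRing.Zmodule_isLmodule.Build A quotmod qscaleA qscale1 qscaleDr qscaleDl.

Lemma qpi_linear : linear qpi.
Proof. by move=> a x y; rewrite qpiD qpiZ. Qed.
HB.instance Definition _ := GRing.isLinear.Build A M quotmod _ qpi qpi_linear.

End Modules.

(** [W (x)_F A] as an [A]-module: the free [A]-module on the set [W] modulo the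
    [F]-linear relations; [tens w a] is the pure tensor [w (x) a].
    See [tensor_univ]. *)

Section Tensor.
Variables (F : fieldType) (A : comAlgType F) (W : lmodType F).

Definition tensor_rel : set {freeg W / A} :=
  [set x | (exists u v : W, x = freeg.Freeg [:: (1, u + v)]
              - freeg.Freeg [:: (1, u)] - freeg.Freeg [:: (1, v)])
        \/ (exists (c : F) (v : W),
              x = freeg.Freeg [:: (1, c *: v)] - freeg.Freeg [:: (c%:A, v)])].

Definition tensor := quotmod tensor_rel.
HB.instance Definition _ := GRing.Lmodule.on tensor.

Definition tens (w : W) (a : A) : tensor :=
  qpi tensor_rel (freeg.Freeg [:: (a, w)]).

Lemma freegZ (a b : A) (w : W) :
  a *: freeg.Freeg [:: (b, w)] = freeg.Freeg [:: (a * b, w)].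
Proof.
by apply/eqP/freeg.freeg_eqP => k; rewrite freeg.coeffZ !freeg.coeffU mulrA.
Qed.

Lemma tensZ (a b : A) w : a *: tens w b = tens w (a * b).
Proof. by rewrite /tens -linearZ /= freegZ. Qed.

Lemma tensDr w (a b : A) : tens w (a + b) = tens w a + tens w b.
Proof. by rewrite /tens -linearD /= freeg.freegUD. Qed.

Lemma tensDl u v (a : A) : tens (u + v) a = tens u a + tens v a.
Proof.
rewrite -[a]mulr1 -!tensZ -scalerDr; congr (_ *: _).
apply/eqP; rewrite -subr_eq0 opprD addrA -!linearB /=.
rewrite -(linear0 (qpi tensor_rel)); apply/eqP/qpi_eq; rewrite subr0.
by apply: sub_gen_smallest; left; exists u, v.
Qed.

Lemma tensZl (c : F) w (a : A) : tens (c *: w) a = tens w (c *: a).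
Proof.
have -> : c *: a = a * c%:A by rewrite mulr_algr.
rewrite -[in LHS](mulr1 a) -!tensZ; congr (_ *: _).
apply/eqP; rewrite -subr_eq0 -linearB /= -(linear0 (qpi tensor_rel)).
apply/eqP/qpi_eq; rewrite subr0.
by apply: sub_gen_smallest; right; exists c, w.
Qed.

Lemma tensor_ind (P : tensor -> Prop) :
  (forall w a, P (tens w a)) -> (forall x y, P x -> P y -> P (x + y)) ->
  forall x, P x.
Proof.
move=> Pt PD x; rewrite -[x](qpiK (S := tensor_rel)).
rewrite -[repr x]freeg.freeg_sumE.
elim: (freeg.dom _) => [|w s IHs].
  rewrite big_nil; have := Pt 0 0; rewrite /tens freeg.freegU0; exact.
by rewrite big_cons linearD; apply: PD => //; exact: Pt.
Qed.

Lemma tensor_univ (N : lmodType A) (f : W -> N) :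
  (forall (c : F) u v, f (c *: u + v) = c%:A *: f u + f v) ->
  exists2 g : {linear tensor -> N}, forall w a, g (tens w a) = a *: f w
    & forall h : {linear tensor -> N}, (forall w, h (tens w 1) = f w) -> h =1 g.
Proof.
move=> f_lin.
have fD u v : f (u + v) = f u + f v.
  by rewrite -[u in LHS]scale1r f_lin scale1r scale1r.
have f0 : f 0 = 0 by apply: (addrI (f 0)); rewrite -fD !addr0.
have fZ (c : F) u : f (c *: u) = c%:A *: f u.
  by rewrite -[_ *: _ in LHS]addr0 f_lin f0 addr0.
pose g0 := freeg.fglift f : {freeg W / A} -> N.
have g0B : {morph g0 : x y / x - y}.
  by move=> x y; rewrite /g0 freeg.lift_is_additive.
have g00 : g0 0 = 0 by rewrite -(subrr 0) g0B subrr.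
have g0D : {morph g0 : x y / x + y}.
  by move=> x y; rewrite -{1}[y]opprK -[- y]sub0r !g0B g00 sub0r opprK.
have g0U a w : g0 (freeg.Freeg [:: (a, w)]) = a *: f w by exact: freeg.liftU.
have g0Z a x : g0 (a *: x) = a *: g0 x.
  rewrite -[x]freeg.freeg_sumE; elim: (freeg.dom _) => [|w s IHs].
    by rewrite big_nil scaler0 g00 scaler0.
  by rewrite big_cons scalerDr !g0D IHs scalerDr freegZ !g0U scalerA.
have ker x : lspan tensor_rel x -> g0 x = 0.
  apply: (smallest_sub (X := [set x | g0 x = 0])) => /=.
    split=> //= a y z /= y0 z0; by rewrite g0D g0Z y0 z0 scaler0 addr0.
  move=> y /= [[u [v ->]]|[c [v ->]]]; rewrite !g0B !g0U.
    by rewrite !scale1r fD -addrA -opprD subrr.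
  by rewrite scale1r fZ subrr.
pose g (x : tensor) := g0 (repr x).
have gpi x : g (qpi _ x) = g0 x.
  apply/eqP; rewrite -subr_eq0 -g0B; apply/eqP/ker/qpi_eq; exact: qpiK.
have g_lin : linear g.
  move=> a x y; rewrite -[x]qpiK -[y]qpiK -linearP !gpi; by rewrite g0D g0Z.
pose gL := GRing.isLinear.Build _ _ _ _ g g_lin.
have [G GE] : exists G : {linear tensor -> N},
    forall w a, G (tens w a) = a *: f w.
  pose G : {linear tensor -> N} := HB.pack g gL.
  by exists G => w a; rewrite /= gpi g0U.
exists G => // h hE; apply: tensor_ind => [w a|x y].
  by rewrite GE -[a in LHS]mulr1 -tensZ linearZ /= hE.
by rewrite !linearD => -> ->.
Qed.

End Tensor.

Section Fps.
Variable F : fieldType.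

Record fps := Fps { fcoef : nat -> F }.

Lemma fpsP (f g : fps) : fcoef f =1 fcoef g -> f = g.
Proof. by case: f g => [f] [g] /= /funext->. Qed.

HB.instance Definition _ := gen_eqMixin fps.
HB.instance Definition _ := gen_choiceMixin fps.

Definition fadd f g := Fps (fun n => fcoef f n + fcoef g n).
Definition fopp f := Fps (fun n => - fcoef f n).
Definition fzero := Fps (fun=> 0).
Definition fone := Fps (fun n => (n == 0%N)%:R).
Definition fmul f g :=
  Fps (fun n => \sum_(i < n.+1) fcoef f i * fcoef g (n - i)%N).
Definition fscale (a : F) f := Fps (fun n => a * fcoef f n).

Lemma faddA : associative fadd.
Proof. by move=> f g h; apply: fpsP => n /=; rewrite addrA. Qed.
Lemma faddC : commutative fadd.
Proof. by move=> f g; apply: fpsP => n /=; rewrite addrC. Qed.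
Lemma fadd0 : left_id fzero fadd.
Proof. by move=> f; apply: fpsP => n /=; rewrite add0r. Qed.
Lemma faddN : left_inverse fzero fopp fadd.
Proof. by move=> f; apply: fpsP => n /=; rewrite addNr. Qed.

HB.instance Definition _ := GRing.isZmodule.Build fps faddA faddC fadd0 faddN.

(* the polynomial with the same first [n] coefficients; it transfers the ring
   laws from [{poly F}] *)
Definition ftrunc n (f : fps) : {poly F} := \poly_(i < n) fcoef f i.

Lemma coef_fmul n m f g : (n < m)%N ->
  fcoef (fmul f g) n = (ftrunc m f * ftrunc m g)`_n.
Proof.
move=> nm; rewrite coefM /=; apply: eq_bigr => i _.
by rewrite !coef_poly !ifT // (leq_ltn_trans _ nm) ?leq_subr // -ltnS.
Qed.

Lemma fmulC : commutative fmul.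
Proof.
by move=> f g; apply: fpsP => n; rewrite !(coef_fmul (m := n.+1)) // mulrC.
Qed.

Lemma fmulA : associative fmul.
Proof.
have E f g n : fcoef (fmul f g) n =
  \sum_(i < n.+1) fcoef f i * fcoef g (n - i)%N by [].
move=> f g h; apply: fpsP => n; pose t := ftrunc n.+1.
transitivity ((t f * (t g * t h))`_n).
  rewrite E coefM; apply: eq_bigr => i _.
  rewrite (coef_fmul (m := n.+1)) ?ltnS ?leq_subr //; congr (_ * _).
  by rewrite coef_poly ltn_ord.
rewrite mulrA E coefM; apply: eq_bigr => i _.
rewrite (coef_fmul (m := n.+1)) //; congr (_ * _).
by rewrite coef_poly ltnS leq_subr.
Qed.

Lemma fmul1 : left_id fone fmul.
Proof.
move=> f; apply: fpsP => n /=; rewrite big_ord_recl /= mul1r subn0 big1 ?addr0 //.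
by move=> i _; rewrite mul0r.
Qed.

Lemma fmulDl : left_distributive fmul +%R.
Proof.
move=> f g h; apply: fpsP => n /=; rewrite -big_split /=.
by apply: eq_bigr => i _; rewrite mulrDl.
Qed.

Lemma fone_neq0 : fone != 0.
Proof.
apply/eqP => /(congr1 (fun f => fcoef f 0)) /= /eqP.
by rewrite oner_eq0.
Qed.

HB.instance Definition _ :=
  GRing.Zmodule_isComNzRing.Build fps fmulA fmulC fmul1 fmulDl fone_neq0.

Lemma fscaleA a b f : fscale a (fscale b f) = fscale (a * b) f.
Proof. by apply: fpsP => n /=; rewrite mulrA. Qed.
Lemma fscale1 : left_id 1 fscale.
Proof. by move=> f; apply: fpsP => n /=; rewrite mul1r. Qed.
Lemma fscaleDr : right_distributive fscale +%R.
Proof. by move=> a f g; apply: fpsP => n /=; rewrite mulrDr. Qed.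
Lemma fscaleDl f : {morph fscale^~ f : a b / a + b}.
Proof. by move=> a b; apply: fpsP => n /=; rewrite mulrDl. Qed.

HB.instance Definition _ :=
  GRing.Zmodule_isLmodule.Build F fps fscaleA fscale1 fscaleDr fscaleDl.

Lemma fscaleAl (a : F) (f g : fps) : a *: (f * g) = (a *: f) * g.
Proof.
apply: fpsP => n /=; rewrite mulr_sumr.
by apply: eq_bigr => i _; rewrite mulrA.
Qed.

HB.instance Definition _ := GRing.Lmodule_isLalgebra.Build F fps fscaleAl.
HB.instance Definition _ := GRing.Lalgebra_isComAlgebra.Build F fps.

Definition funit : pred fps := fun f => fcoef f 0 != 0.

(* [f^-1 = f_0^-1 * \sum_k (1 - f / f_0)^k] *)
Definition finv (f : fps) : fps :=
  if funit f then
    Fps (fun n => (fcoef f 0)^-1 *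
      fcoef (\sum_(k < n.+1) (1 - (fcoef f 0)^-1 *: f) ^+ k) n)
  else f.

Lemma fcoefD f g n : fcoef (f + g) n = fcoef f n + fcoef g n.
Proof. by []. Qed.
Lemma fcoef_sum (I : Type) (r : seq I) (h : I -> fps) n :
  fcoef (\sum_(i <- r) h i) n = \sum_(i <- r) fcoef (h i) n.
Proof. by apply: (big_morph (fcoef^~ n)) => // f g. Qed.
Lemma fcoefM f g n :
  fcoef (f * g) n = \sum_(i < n.+1) fcoef f i * fcoef g (n - i)%N.
Proof. by []. Qed.

Lemma fcoefX_small (g : fps) n k : fcoef g 0 = 0 -> (n < k)%N ->
  fcoef (g ^+ k) n = 0.
Proof.
move=> g0; elim: k n => // k IHk n nk.
rewrite exprS fcoefM big1 // => i _; case: (posnP i) => [->|i_gt0].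
  by rewrite g0 mul0r.
case: (posnP n) => [n0|n_gt0]; first by case: i i_gt0; rewrite n0 => -[].
by rewrite IHk ?mulr0 //; apply: (@leq_trans n) => //; rewrite ltn_subrL i_gt0.
Qed.

Lemma fmulVf : {in funit, left_inverse 1 finv *%R}.
Proof.
move=> f fu; have f0 : fcoef f 0 != 0 := fu.
pose g := 1 - (fcoef f 0)^-1 *: f.
have g0 : fcoef g 0 = 0 by rewrite /g /= mulVf // subrr.
have fE : f = fcoef f 0 *: (1 - g).
  by rewrite /g opprB addrC subrK scalerA divff // scale1r.
apply: fpsP => n; rewrite mulrC.
transitivity (fcoef (((fcoef f 0)^-1 *: f) * \sum_(k < n.+1) g ^+ k) n).
  rewrite !fcoefM; apply: eq_bigr => i _.
  rewrite /finv ifT //= -/g mulrCA mulrA; congr (_ * _).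
  rewrite !fcoef_sum -!(big_mkord predT (fun k => fcoef (g ^+ k) (n - i))).
  rewrite [RHS](@big_cat_nat _ _ _ (n - i).+1) //= ?ltnS ?leq_subr //.
  rewrite [X in _ + X]big_nat_cond [X in _ + X]big1 ?addr0 // => k.
  by rewrite andbT => /andP[ki _]; exact: fcoefX_small.
have -> : (fcoef f 0)^-1 *: f = 1 - g.
  by rewrite {2}fE scalerA mulVf // scale1r.
rewrite -[1 - g]opprB mulNr -subrX1 opprB fcoefD /=.
by rewrite fcoefX_small // oppr0 addr0.
Qed.

Lemma funitP (f g : fps) : g * f = 1 -> funit f.
Proof.
move/(congr1 (fcoef^~ 0)); rewrite fcoefM big_ord1 /= => gf1.
by apply/eqP => f0; move/eqP: gf1; rewrite f0 mulr0 eq_sym oner_eq0.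
Qed.

Lemma finv_out : {in [predC funit], finv =1 id}.
Proof. by move=> f /negbTE fNu; rewrite /finv (fNu : funit f = false). Qed.

HB.instance Definition _ :=
  GRing.ComNzRing_hasMulInverse.Build fps fmulVf funitP finv_out.

Definition fvar : fps := Fps (fun n => (n == 1%N)%:R).

End Fps.

Section GeneratedSubalgebra.
Variables (F : fieldType) (A : comAlgType F) (S : set A).

Definition subalg_gen : {pred A} := fun x =>
  `[< forall T : {pred A}, subalg_closed T -> S `<=` [set` T] -> x \in T >].

Lemma subalg_gen_closed : subalg_closed subalg_gen.
Proof.
split=> [|a x y /asboolP Sx /asboolP Sy|x y /asboolP Sx /asboolP Sy];
  apply/asboolP => T Talg ST; have [T1 TD TM] := Talg; first exact: T1.
  by apply: TD; [exact: Sx|exact: Sy].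
by apply: TM; [exact: Sx|exact: Sy].
Qed.
HB.instance Definition _ := GRing.isSubalgClosed.Build F A subalg_gen
  subalg_gen_closed.

Record subalg := Subalg { subalg_val :> A; _ : subalg_val \in subalg_gen }.

HB.instance Definition _ := [isSub for subalg_val].
HB.instance Definition _ := [Choice of subalg by <:].
HB.instance Definition _ := [SubChoice_isSubComNzRing of subalg by <:].
HB.instance Definition _ := [SubZmodule_isSubLmodule of subalg by <:].
HB.instance Definition _ := [SubNzRing_SubLmodule_isSubLalgebra of subalg by <:].
HB.instance Definition _ := [SubLalgebra_isSubAlgebra of subalg by <:].
HB.instance Definition _ := GRing.ComNzRing.on subalg.

End GeneratedSubalgebra.

(** A vertex operator [Y(a, z) = \sum_n a_(n) z^(-n-1)] is given by its modes:
    [Y a n] is the endomorphism [a_(n)].  The sums [\sum_(i \in [set: nat])]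
    are the finitely supported sums of the library. *)

Section VertexAlgebra.
Variable C : numFieldType.

Definition gbinom (z : int) (i : nat) : C :=
  (\prod_(j < i) (z - j%:Z))%:~R / i`!%:R.

(** Jacobi identity for a space [V] of states acting on [W], in components
    (Borcherds identity). *)
Definition borcherds (V W : lmodType C)
    (Y : V -> int -> V -> V) (YW : V -> int -> W -> W) : Prop :=
  forall (a b : V) (w : W) (p q r : int),
    \sum_(i \in [set: nat])
      gbinom p i *: YW (Y a (r + i%:Z) b) (p + q - i%:Z) w =
    \sum_(i \in [set: nat])
      ((-1) ^+ i * gbinom r i) *:
        (YW a (p + r - i%:Z) (YW b (q + i%:Z) w)
         - ((-1) ^ r : C) *: YW b (q + r - i%:Z) (YW a (p + i%:Z) w)).

Record weak_module_axioms (V W : lmodType C)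
    (Y : V -> int -> V -> V) (one : V) (YW : V -> int -> W -> W) : Prop := {
  mode_linearl : forall n w, linear (fun a => YW a n w);
  mode_linearr : forall a n, linear (YW a n);
  mode_truncation : forall a w,
    exists N : nat, forall n : nat, (N <= n)%N -> YW a n%:Z w = 0;
  mode_vacuum : forall n w, YW one n w = if n == -1 then w else 0;
  mode_jacobi : borcherds Y YW
}.

(** A direct sum decomposition [M = \bigoplus_n M_n], given by the projections
    [pr n] of [M] onto [M_n]. *)
Record grading_axioms (M : lmodType C) (pr : nat -> M -> M) : Prop := {
  proj_linear : forall n, linear (pr n);
  proj_ortho : forall m n x, pr m (pr n x) = if m == n then pr n x else 0;
  proj_sum : forall x, exists N : nat,
    (forall n, (N <= n)%N -> pr n x = 0) /\ x = \sum_(n < N) pr n x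
}.

Definition homog (M : lmodType C) (pr : nat -> M -> M) (n : nat) : set M :=
  [set x | pr n x = x].

(** Homogeneous subspaces with integer index, [M_n = 0] for [n < 0]. *)
Definition homogz (M : lmodType C) (pr : nat -> M -> M) (n : int) : set M :=
  if n is Posz k then homog pr k else [set 0].

Definition virasoro_mode (V W : lmodType C) (YW : V -> int -> W -> W)
    (omega : V) (n : int) : W -> W := YW omega (n + 1).

Record voa := VOA {
  voa_space :> lmodType C;
  voa_Y : voa_space -> int -> voa_space -> voa_space;
  voa_one : voa_space;
  voa_omega : voa_space;
  voa_c : C;
  voa_proj : nat -> voa_space -> voa_space;
  voa_grading : grading_axioms voa_proj;
  voa_findim : forall n, fin_gen (homog voa_proj n);
  voa_vertex : weak_module_axioms voa_Y voa_one voa_Y;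
  voa_creation : forall a (n : nat), voa_Y a n%:Z voa_one = 0;
  voa_state : forall a, voa_Y a (-1) voa_one = a;
  voa_one_wt : homog voa_proj 0 voa_one;
  voa_omega_wt : homog voa_proj 2 voa_omega;
  voa_virasoro : forall (m n : int) v,
    let L := virasoro_mode voa_Y voa_omega in
    L m (L n v) - L n (L m v) =
      (m - n)%:~R *: L (m + n) v
      + (if m + n == 0 then (m ^+ 3 - m)%:~R / 12%:R * voa_c else 0) *: v;
  voa_L0 : forall n v, homog voa_proj n v ->
    virasoro_mode voa_Y voa_omega 0 v = n%:R *: v;
  voa_deriv : forall a (n : int) v,
    voa_Y (virasoro_mode voa_Y voa_omega (-1) a) n v
      = - (n%:~R *: voa_Y a (n - 1) v)
}.

Record admissible_module (V : voa) := AdmissibleModule {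
  adm_space :> lmodType C;
  adm_Y : V -> int -> adm_space -> adm_space;
  adm_proj : nat -> adm_space -> adm_space;
  adm_weak : weak_module_axioms (@voa_Y V) (voa_one V) adm_Y;
  adm_grading : grading_axioms adm_proj;
  adm_degree : forall (k : nat) a (m : int) (n : nat) w,
    homog (@voa_proj V) k a -> homog adm_proj n w ->
    homogz adm_proj (k%:Z - m - 1 + n%:Z) (adm_Y a m w)
}.

Section Module.
Variables (V : voa) (W : admissible_module V).
Local Notation Y := (@adm_Y V W).

Definition Lmode : int -> W -> W := virasoro_mode Y (voa_omega V).

(** [h] is the conformal weight; the first clause is semisimplicity of [L(0)]. *)
Definition ordinary (h : C) : Prop :=
  (forall w : W, exists s : seq W,
     (forall x, x \in s -> exists c : C, Lmode 0 x = c *: x)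
     /\ w = \sum_(x <- s) x) /\
  (forall n, homog (@adm_proj V W) n = [set w | Lmode 0 w = (h + n%:R) *: w]) /\
  (forall n, fin_gen (homog (@adm_proj V W) n)).

(** Submodules are not required to be graded; for ordinary modules they are,
    since they are stable under [L(0)]. *)
Definition irreducible_module : Prop :=
  (exists w : W, w <> 0) /\
  forall U : set W, submodule U ->
    (forall a n w, U w -> U (Y a n w)) -> U = [set 0] \/ U = setT.

Definition C2_gen : set W := [set x | exists a w, x = Y a (-2) w].

(** Finite generation over the field [C] is finite dimension. *)
Definition C2_cofinite : Prop := fin_gen [set: quotmod C2_gen].

End Module.
End VertexAlgebra.

Section Torus.
Variable K : realType.
Local Notation C := (K[i]).

Definition twopii : C := Complex 0 (2 * pi).

(** [log(1 + z) / z] *)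
Definition flog : fps C := Fps (fun n => (-1) ^+ n / n.+1%:R).

Section SquareModes.
Variables (V : voa C) (W : admissible_module V).

(** [a[m]] for [a] of weight [k].  As [log(1+z)^m = z^m * flog^m], the residue
    of [Y(a, z) log(1+z)^m (1+z)^(k-1)] is the sum over [j] of the coefficient of
    [z^j] in [flog^m (1+z)^(k-1)] times [a_(m+j)]. *)
Definition sqmode_homog (k : nat) (a : V) (m : int) (w : W) : W :=
  twopii ^ (- m - 1) *: \sum_(j \in [set: nat])
    fcoef (flog ^ m * (1 + fvar C) ^ (k%:Z - 1)) j *: adm_Y a (m + j%:Z) w.

Definition sqmode (a : V) (m : int) (w : W) : W :=
  \sum_(k \in [set: nat]) sqmode_homog k (voa_proj k a) m w.

Definition omegat : V :=
  twopii ^+ 2 *: (voa_omega V - (voa_c V / 24%:R) *: voa_one V).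

(** The mode [L[n]] of the conformal vector [omegat]. *)
Definition Lsq (n : int) : W -> W := sqmode omegat (n + 1).

End SquareModes.

Definition zeta_even (k : nat) : K :=
  limn (series (fun n : nat => (n.+1%:R ^- (2 * k)) : K)).

Definition sigma (e n : nat) : nat := \sum_(d <- divisors n) d ^ e.

(** [G_(2k)], for [k >= 1] *)
Definition eisenstein (k : nat) : fps C :=
  Fps (fun n => if n == 0%N then 2%:R * Complex (zeta_even k) 0
    else 2%:R * twopii ^+ (2 * k) / (2 * k - 1)`!%:R
         * (sigma (2 * k - 1) n)%:R).

(** [C[G_2, G_4, G_6]] inside [C[[q]]] *)
Definition qmodular : comAlgType C :=
  subalg [set eisenstein 1; eisenstein 2; eisenstein 3].

(** [G_(2k)] as an element of [R]; the default value [0] is never used for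
    [k >= 1], since all [G_(2k)] are polynomials in [G_2], [G_4], [G_6]. *)
Definition eisensteinR (k : nat) : qmodular :=
  insubd (0 : subalg [set eisenstein 1; eisenstein 2; eisenstein 3])
    (eisenstein k).

Section Coinvariants.
Variables (V : voa C) (W : admissible_module V).

Definition WR : lmodType qmodular := tensor qmodular W.

Definition torus_gen : set WR :=
  [set x | (exists (a : V) (v : W), x = tens (sqmode a 0 v) 1)
    \/ (exists (a : V) (v : W) (m : nat), (2 <= m)%N /\
          x = tens (sqmode a (- m%:Z) v) 1
            + (-1) ^+ m *: \sum_(k \in [set k : nat | (1 <= k)%N])
                tens (sqmode a ((2 * k)%:Z - m%:Z) v)
                     (eisensteinR k *+ 'C(2 * k - 1, m - 1)))].

(** [L_(E_tau \ p)(V).(W (x) R)] *)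
Definition torus_sub : set WR := lspan torus_gen.

Definition coinvariants : lmodType qmodular := quotmod torus_gen.

End Coinvariants.
End Torus.

Arguments torus_sub {K V} W _.
Arguments Lsq {K V} W n _.

(* Main.v *)
Require Import Defs.
From mathcomp Require Import all_boot all_order all_algebra.
From mathcomp Require Import complex boolp classical_sets reals.
From mathcomp Require Import finmap cardinality fsbigop trigo zify.

(** Leading terms of the relations: the coefficient of [a_(-2) v] in [a[-2] v] is
    [2 pi i], all the other terms of [a[-2] v] have lower degree, and modulo the
    torus relations [a[-2] v] is an [R]-combination of the [a[2k-2] v], [k >= 1],
    which also have lower degree.  By [C_2]-cofiniteness every element of large
    degree is a sum of elements [a_(-2) v] of the same degree, so the coinvariants
    are generated over [R] by the finitely many finite-dimensional [W(n)] of small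
    degree.

    The ring [R] is a quotient of a polynomial ring in three variables, hence
    noetherian by Hilbert's basis theorem.  In the finitely generated [R]-module of
    coinvariants the classes of the [L[-2]^i v] thus span the same submodule as
    finitely many of them, which gives the monic relation. *)

Set Implicit Arguments.
Unset Strict Implicit.
Unset Printing Implicit Defensive.

Import Order.TTheory GRing.Theory Num.Theory.

Local Open Scope ring_scope.
Local Open Scope classical_set_scope.

(** * Spans and noetherian modules *)

Section Submodules.
Variables (A : nzRingType) (M : lmodType A).
Implicit Types (S U : set M).

Lemma submoduleD U x y : submodule U -> U x -> U y -> U (x + y).
Proof. by case=> _ UD Ux Uy; rewrite -[x]scale1r; exact: UD. Qed.

Lemma submoduleZ U a x : submodule U -> U x -> U (a *: x).
Proof. by case=> U0 UD Ux; rewrite -[_ *: _]addr0; exact: UD. Qed.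

Lemma submoduleB U x y : submodule U -> U x -> U y -> U (x - y).
Proof.
by move=> sU Ux Uy; rewrite -scaleN1r; apply: submoduleD (submoduleZ _ sU _).
Qed.

Lemma submodule_sum U (I : Type) {r : seq I} {P : pred I} {F : I -> M} :
  submodule U -> (forall i, P i -> U (F i)) -> U (\sum_(i <- r | P i) F i).
Proof.
move=> sU UF; apply: (big_ind U) => //; first exact: sU.1.
by move=> x y; exact: submoduleD.
Qed.

(** The sum runs over a finite sequence of indices in [D], empty if the support is infinite, so the
    default value 0 is covered as well. *)
Lemma submodule_fsum U (I : choiceType) {D : set I} {F : I -> M} :
  submodule U -> (forall i, D i -> U (F i)) -> U (\sum_(i \in D) F i).
Proof.
move=> sU UF; rewrite big_seq; apply: submodule_sum => // i.
case: finite_supportP => // X XD _ _ iX; exact/UF/XD.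
Qed.

Lemma lspan_gen S : S `<=` lspan S.
Proof. exact: sub_gen_smallest. Qed.

Lemma lspan_sub S U : submodule U -> S `<=` U -> lspan S `<=` U.
Proof. exact: smallest_sub. Qed.

Lemma lspanS S T : S `<=` T -> lspan S `<=` lspan T.
Proof.
move=> ST; apply: lspan_sub; first exact: lspan_submodule.
exact: subset_trans (@lspan_gen T).
Qed.

Lemma lspan_cons x (s : seq M) y :
  lspan [set` x :: s] y -> exists a z, lspan [set` s] z /\ y = a *: x + z.
Proof.
have [s0 sD] := lspan_submodule [set` s].
apply: (lspan_sub (U := [set y | exists a z, lspan [set` s] z /\ y = a *: x + z])).
  split=> [|a _ _ [b [z [sz ->]]] [c [t [st ->]]]].
    by exists 0, 0; rewrite scale0r addr0.
  exists (a * b + c), (a *: z + t); split; first exact: sD.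
  by rewrite scalerDl scalerDr scalerA addrACA.
move=> z /=; rewrite inE => /orP[/eqP->|sz].
  by exists 1, 0; rewrite scale1r addr0.
by exists 0, z; rewrite scale0r add0r; split=> //; exact: lspan_gen.
Qed.

Lemma lspan_ord n (u : 'I_n -> M) x :
  lspan (range u) x -> exists g : 'I_n -> A, x = \sum_(i < n) g i *: u i.
Proof.
apply: (lspan_sub
  (U := [set x | exists g : 'I_n -> A, x = \sum_(i < n) g i *: u i])).
  split=> [|a _ _ [f ->] [g ->]].
    by exists (fun=> 0); rewrite big1 // => i _; rewrite scale0r.
  exists (fun i => a * f i + g i); rewrite scaler_sumr -big_split.
  by apply: eq_bigr => i _; rewrite scalerDl scalerA.
move=> _ [i _ <-]; exists (fun j => (j == i)%:R); rewrite (bigD1 i) //= eqxx scale1r.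
by rewrite big1 ?addr0 // => j /negbTE->; rewrite scale0r.
Qed.

Definition noetherian_module := forall U, submodule U -> fin_gen U.

(* The span of the sequence is finitely generated, hence already the span of
   one of its initial segments. *)
Lemma noetherian_seq (u : nat -> M) : noetherian_module ->
  exists n (g : 'I_n -> A), u n = \sum_(i < n) g i *: u i.
Proof.
move=> /(_ _ (lspan_submodule (range u))) [s sE].
pose P n := lspan (range (fun i : 'I_n => u i)).
have P_mono m n x : (m <= n)%N -> P m x -> P n x.
  move=> mn; apply: lspanS => _ [i _ <-]; by exists (widen_ord mn i).
have uP y : lspan (range u) y -> exists n, P n y.
  apply: (lspan_sub (U := [set y | exists n, P n y])).
    split=> [|a x z [m Pm] [n Pn]]; first by exists 0%N; exact: (lspan_submodule _).1.
    exists (maxn m n); apply: (lspan_submodule _).2.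
      exact: P_mono (leq_maxl _ _) _.
    exact: P_mono (leq_maxr _ _) _.
  by move=> _ [n _ <-]; exists n.+1; apply: lspan_gen; exists ord_max.
(* The spans [P n] increase with [n] and [s] is finite, so one [P n] contains all generators. *)
have [n sn] : exists n, forall y, y \in s -> P n y.
  have : forall y, y \in s -> exists n, P n y.
    by move=> y ys; apply: uP; rewrite -sE; exact: lspan_gen.
  elim: (s) => [|y r IHr] H; first by exists 0%N.
  have [|m Hm] := IHr; first by move=> z zr; apply: H; rewrite inE zr orbT.
  have [n Hn] := H y (mem_head _ _).
  exists (maxn m n) => z; rewrite inE => /orP[/eqP->|/Hm].
    exact: P_mono (leq_maxr _ _) _.
  exact: P_mono (leq_maxl _ _).
exists n; apply: lspan_ord.
have : lspan [set` s] (u n) by rewrite sE; apply: lspan_gen; exists n.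
exact: (lspan_sub (lspan_submodule _)).
Qed.

Lemma fin_gen_span U (s : seq M) : submodule U ->
  (forall y, y \in s -> U y) -> U `<=` lspan [set` s] -> fin_gen U.
Proof.
move=> sU Us Usub; exists s; apply/seteqP; split=> //.
by apply: lspan_sub => // y /=; exact: Us.
Qed.

End Submodules.

(** Bounding [U] by a span, instead of generating all of [M], lets the induction on [s] pass to the
    tail inside the same module. *)
Lemma noetherian_fin_gen_sub (A : nzRingType) (M : lmodType A) (s : seq M)
    (U : set M) :
  noetherian_module A^o -> submodule U -> U `<=` lspan [set` s] -> fin_gen U.
Proof.
move=> noeA; elim: s U => [|x s IHs] U sU Us.
  by apply: (@fin_gen_span _ _ _ [::]).
have [s0 sD] := lspan_submodule [set` s]; have [U0 UD] := sU.
(* The coefficients of [x] along [U] form an ideal [I]; lift its generators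
   to [U] and recurse on the elements of [U] without such a coefficient. *)
pose I : set A^o := [set a | exists z, lspan [set` s] z /\ U (a *: x + z)].
have [r rE] : fin_gen I.
  apply: noeA; split; first by exists 0; rewrite scale0r addr0.
  move=> a b c [y [sy Uy]] [z [sz Uz]]; exists (a *: y + z); split; first exact: sD.
  by have := UD a _ _ Uy Uz; rewrite scalerDr scalerA addrACA -scalerDl.
have [t [tU tr]] : exists t : seq M, (forall y, y \in t -> U y) /\
    forall a, a \in r -> exists2 y, lspan [set` t] y & lspan [set` s] (y - a *: x).
  have : forall a, a \in r -> I a by move=> a ar; rewrite -rE; exact: lspan_gen.
  elim: (r) => [|a q IHq] Iq; first by exists [::].
  have [|t [tU tq]] := IHq; first by move=> b bq; apply: Iq; rewrite inE bq orbT.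
  have [z [sz Uz]] := Iq a (mem_head _ _).
  exists ((a *: x + z) :: t); split.
    by move=> y; rewrite inE => /orP[/eqP->|/tU].
  move=> b; rewrite inE => /orP[/eqP->|/tq[y ty sy]].
    by exists (a *: x + z); [apply: lspan_gen => /=; exact: mem_head
                            |rewrite addrC addKr].
  exists y => //; apply: lspanS ty => w /= wt; by rewrite inE wt orbT.
have tI a : I a -> exists2 y, lspan [set` t] y & lspan [set` s] (y - a *: x).
  rewrite -rE; apply: (lspan_sub (M := A^o) (U := [set a |
    exists2 y, lspan [set` t] y & lspan [set` s] (y - a *: x)])); last exact: tr.
  have [t0 tD] := lspan_submodule [set` t].
  split=> [|b c d [y ty sy] [z tz sz]].
    by exists 0 => //=; rewrite scale0r subrr.
  exists (b *: y + z); first exact: tD.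
  have := sD b _ _ sy sz; rewrite scalerBr scalerA addrACA -opprD -scalerDl.
  exact.
have [t' t'E] : fin_gen (U `&` lspan [set` s]).
  apply: IHs; last exact: subIsetr.
  split=> [|a y z [Uy sy] [Uz sz]]; split=> //; [exact: UD|exact: sD].
have t't : lspan [set` t'] `<=` lspan [set` t ++ t'].
  by apply: lspanS => w /= wt; rewrite mem_cat wt orbT.
have tt : lspan [set` t] `<=` lspan [set` t ++ t'].
  by apply: lspanS => w /= wt; rewrite mem_cat wt.
have t'U w : lspan [set` t'] w -> U w by rewrite t'E => -[].
apply: (@fin_gen_span _ _ _ (t ++ t')) => // [y|y Uy].
  by rewrite mem_cat => /orP[/tU//|yt']; apply: t'U; exact: lspan_gen.
have [a [z [sz yE]]] := lspan_cons (Us _ Uy).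
have [|w tw sw] := tI a; first by exists z; split=> //; rewrite -yE.
have sT := lspan_submodule [set` t ++ t'].
(* As [y = a *: x + z] and [w - a *: x] is in the span of [s], the difference [y - w] lies in [U]
   and in the span of [s], hence in the span of [t']. *)
rewrite -[y](subrK w); apply: (submoduleD sT).
  apply: t't; rewrite t'E; split.
    by apply: submoduleB => //; exact: (lspan_sub sU tU).
  suff -> : y - w = z - (w - a *: x) by exact: (submoduleB (lspan_submodule _)).
  by rewrite yE opprB addrCA addrA.
exact: tt.
Qed.

Lemma noetherian_fin_gen (A : nzRingType) (M : lmodType A) :
  noetherian_module A^o -> fin_gen [set: M] -> noetherian_module M.
Proof.
move=> noeA [s sE] U sU; apply: (noetherian_fin_gen_sub (s := s)) => //.
by rewrite sE.
Qed.

Lemma noetherian_field (F : fieldType) : noetherian_module F^o.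
Proof.
move=> U sU; have [[a [Ua a0]]|U0] := pselect (exists a, U a /\ a != 0).
  apply: (@fin_gen_span _ _ _ [:: a : F^o]) => // [y|y Uy].
    by rewrite inE => /eqP->.
  rewrite -[y](divfK a0); apply: (submoduleZ (M := F^o) _ (lspan_submodule _)).
  by apply: lspan_gen; rewrite /= inE.
apply: (@fin_gen_span _ _ _ [::]) => // y Uy.
suff -> : y = 0 by exact: (lspan_submodule _).1.
by apply/eqP/negPn/negP => y0; apply: U0; exists y.
Qed.

Lemma noetherian_image (A B : nzRingType) (phi : {rmorphism A -> B}) :
  (forall b, exists a, phi a = b) ->
  noetherian_module A^o -> noetherian_module B^o.
Proof.
move=> phi_surj noeA U sU; have [U0 UD] := sU.
have [|s sE] := noeA [set a : A^o | U (phi a)].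
  split=> /= [|a x y Ux Uy]; first by rewrite rmorph0.
  by rewrite rmorphD rmorphM; exact: UD.
apply: (@fin_gen_span _ B^o _ (map phi s)) => // [y /mapP[a as_ ->]|y Uy].
  have : lspan [set` s] a by exact: lspan_gen.
  by rewrite sE.
have [a aE] := phi_surj y.
have : lspan [set` s] a by rewrite sE /= aE.
rewrite -aE.
have [s0 sD] := lspan_submodule (M := B^o) [set` map phi s].
apply: (lspan_sub (M := A^o)
  (U := [set a : A^o | lspan (M := B^o) [set` map phi s] (phi a)])).
  split=> /= [|b x z sx sz]; first by rewrite rmorph0.
  by rewrite rmorphD rmorphM; exact: sD.
by move=> x sx; apply: lspan_gen => /=; exact: map_f.
Qed.

(** * Hilbert's basis theorem and the noetherian property of [R] *)

Section HilbertBasis.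
Variable A : comNzRingType.
Implicit Types p q f : {poly A}.

Lemma hilbert_basis : noetherian_module A^o -> noetherian_module {poly A}^o.
Proof.
move=> noeA U sU; have [U0 UD] := sU.
have UM p q : U q -> U (p * q) by exact: (submoduleZ p sU).
(* The coefficient [a] in formal degree [n] may vanish; this makes the set [L] of leading
   coefficients closed under sums. *)
pose lc n p a := (size p <= n.+1)%N /\ p`_n = a.
have lcX k n p a : lc n p a -> lc (k + n)%N ('X^k * p) a.
  case=> pn pa; split; last by rewrite coefXnM ltnNge leq_addr addKn.
  rewrite (leq_trans (size_polyMleq _ _)) // size_polyXn addSn /=.
  by rewrite -addnS leq_add2l.
have lcP n a b c p q : lc n p b -> lc n q c -> lc n (a%:P * p + q) (a * b + c).
  move=> [pn pb] [qn qc]; split; last by rewrite coefD coefCM pb qc.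
  rewrite (leq_trans (size_polyD _ _)) // geq_max qn andbT mul_polyC.
  exact: leq_trans (size_scale_leq _ _) _.
pose L : set A^o := [set a | exists n, exists2 p, U p & lc n p a].
have [r rE] : fin_gen L.
  apply: noeA; split; first by exists 0%N, 0 => //; split; rewrite ?size_poly0 ?coef0.
  move=> a b c [m [p Up pb]] [n [q Uq qc]]; exists (n + m)%N.
  exists (a%:P * ('X^n * p) + 'X^m * q).
    exact: (submoduleD sU (UM _ _ (UM _ _ Up)) (UM _ _ Uq)).
  by apply: lcP; [exact: lcX|rewrite addnC; exact: lcX].
(* [t] lifts the generators of [L] to [U], and [d] bounds the formal degrees of the lifts;
   multiplying by powers of ['X] reaches every degree from [d] on. *)
have [t [d [tU tr]]] : exists (t : seq {poly A}^o) (d : nat),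
    (forall p, p \in t -> U p) /\
    forall a, a \in r -> forall n, (d <= n)%N ->
      exists2 f, lspan [set` t] f & lc n f a.
  have : forall a, a \in r -> L a by move=> a ar; rewrite -rE; exact: lspan_gen.
  elim: (r) => [|a s IHs] Ls; first by exists [::], 0%N.
  have [|t [d [tU ts]]] := IHs; first by move=> b bs; apply: Ls; rewrite inE bs orbT.
  have [m [p Up pa]] := Ls a (mem_head _ _).
  exists (p :: t), (maxn m d); split=> [q|b].
    by rewrite inE => /orP[/eqP->|/tU].
  rewrite inE => /orP[/eqP->|/ts bs] n; rewrite geq_max => /andP[mn dn].
    exists ('X^(n - m) * p); last by rewrite -{1}(subnK mn); exact: lcX.
    apply: (submoduleZ (M := {poly A}^o) _ (lspan_submodule _)).
    by apply: lspan_gen => /=; exact: mem_head.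
  have [f tf fb] := bs n dn; exists f => //.
  apply: lspanS tf => w /= wt; by rewrite inE wt orbT.
have tL a n : L a -> (d <= n)%N -> exists2 f, lspan [set` t] f & lc n f a.
  rewrite -rE => ra dn; move: a ra.
  apply: (lspan_sub (M := A^o) (U := [set a : A^o |
    exists2 f, lspan (M := {poly A}^o) [set` t] f & lc n f a])).
    have [t0 tD] := lspan_submodule (M := {poly A}^o) [set` t].
    split=> [|a b c [p tp pb] [q tq qc]].
      by exists 0 => //; split; rewrite ?size_poly0 ?coef0.
    by exists (a%:P * p + q); [exact: tD|exact: lcP].
  by move=> a /tr; apply.
(* The elements of [U] of degree below [d] form an [A]-submodule of the span of finitely many
   monomials. *)
have [t' t'E] : fin_gen [set p : {poly A} | U p /\ (size p <= d)%N].
  apply: (noetherian_fin_gen_sub (s := [seq 'X^i | i <- iota 0 d])) => //.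
    split=> [|a p q [Up pd] [Uq qd]]; first by rewrite /= size_poly0.
    split; first by rewrite -mul_polyC; exact: UD.
    rewrite (leq_trans (size_polyD _ _)) // geq_max qd andbT.
    exact: leq_trans (size_scale_leq _ _) _.
  move=> p [_ pd]; rewrite -[p]coefK poly_def.
  apply: (submodule_sum (lspan_submodule _)) => i _.
  apply: (submoduleZ (M := {poly A}) _ (lspan_submodule _)).
  apply: lspan_gen; apply/mapP; exists (val i) => //.
  by rewrite mem_iota (leq_trans (ltn_ord i)).
have sT := lspan_submodule (M := {poly A}^o) [set` t ++ t'].
have tt : lspan (M := {poly A}^o) [set` t]
    `<=` lspan (M := {poly A}^o) [set` t ++ t'].
  by apply: lspanS => w /= wt; rewrite mem_cat wt.
apply: (@fin_gen_span _ {poly A}^o _ (t ++ t')) => // [p|p Up].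
  rewrite mem_cat => /orP[/tU//|pt'].
  have : lspan [set` t'] p by exact: lspan_gen.
  by rewrite t'E => -[].
have [n] := ubnP (size p); elim: n p Up => // n IHn p Up; rewrite ltnS => pn.
have [pd|dp] := leqP (size p) d.
  have : lspan [set` t'] p by rewrite t'E.
  (* [t'] generates over [A]; constant polynomials turn this into a combination over [{poly A}]. *)
  apply: (lspan_sub (U := lspan (M := {poly A}^o) [set` t ++ t'] : set {poly A})).
    split=> [|a f g sf sg]; first exact: sT.1.
    by rewrite -mul_polyC; exact: sT.2.
  by move=> f tf; apply: lspan_gen; rewrite /= mem_cat tf orbT.
case sp: (size p) dp pn => [//|m] dm mn.
(* Since [p] has size [m.+1 > d], its leading coefficient in degree [m >= d] is attained by some [f]
   in the span of [t], and [p - f] has size at most [m]. *)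
have [|//|f tf [fm fE]] := tL p`_m m; first by exists m, p => //; split; rewrite ?sp.
rewrite -[p](subrK f); apply: (submoduleD sT); last exact: tt.
apply: IHn.
  by apply: (submoduleB sU) => //; exact: (lspan_sub sU tU).
apply: leq_trans mn; rewrite ltnS; apply/leq_sizeP => j.
rewrite leq_eqVlt => /orP[/eqP<-|mj]; rewrite coefB ?fE ?subrr //.
by rewrite !nth_default ?subrr ?sp // (leq_trans fm).
Qed.

End HilbertBasis.

(** [P] is an iterated polynomial ring over [F], with one variable for each entry of [s], evaluated
    at that entry. The clause on constants makes the image of [phi] a subalgebra. *)
Lemma noetherian_cover (F : fieldType) (B : comAlgType F) (s : seq B) :
  exists (P : comNzRingType) (phi : {rmorphism P -> B}),
    [/\ noetherian_module P^o, forall c : F, exists p, phi p = c%:A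
      & forall b, b \in s -> exists p, phi p = b].
Proof.
elim: s => [|b s [P [phi [noeP phiF phis]]]].
  exists F, (in_alg B); split=> // [|c]; first exact: noetherian_field.
  by exists c.
have cfb : commr_rmorph phi b by move=> p; exact: mulrC.
exists {poly P}, (horner_morph cfb : {rmorphism {poly P} -> B}).
split=> [|c|x]; first exact: hilbert_basis.
  by have [p <-] := phiF c; exists p%:P; exact: horner_morphC.
rewrite inE => /orP[/eqP->|/phis[p <-]].
  by exists 'X; exact: horner_morphX.
by exists p%:P; exact: horner_morphC.
Qed.

Lemma noetherian_subalg (F : fieldType) (A : comAlgType F) (S : set A)
    (s : seq A) : S `<=` [set` s] -> noetherian_module (subalg S)^o.
Proof.
move=> Ss; have [P [phi [noeP phiF phis]]] :=
  noetherian_cover (pmap insub s : seq (subalg S)).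
apply: (noetherian_image (phi := phi)) noeP => -[b bS].
(* The image of [phi] in [A] is a subalgebra containing [S], so it contains every element of
   [subalg S]. *)
pose T : {pred A} := fun x => `[< exists p, val (phi p) = x >].
have /asboolP[p pb] : b \in T.
  move: bS => /asboolP; apply.
    split=> [|c x y /asboolP[p <-] /asboolP[q <-]|x y /asboolP[p <-] /asboolP[q <-]];
      apply/asboolP.
    - by exists 1; rewrite rmorph1.
    - have [r rc] := phiF c; exists (r * p + q).
      by rewrite rmorphD rmorphM rc mulr_algl.
    - by exists (p * q); rewrite rmorphM.
  move=> x Sx; apply/asboolP.
  have xS : x \in subalg_gen S by apply/asboolP => U _; exact.
  have [|p pE] := phis (Subalg xS); last by exists p; rewrite pE.
  by rewrite mem_pmap_sub; exact: Ss.
by exists p; exact/val_inj.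
Qed.

Lemma noetherian_qmodular (K : realType) : noetherian_module (qmodular K)^o.
Proof.
apply: (noetherian_subalg
  (s := [:: eisenstein K 1; eisenstein K 2; eisenstein K 3])).
by move=> x /= [[]|] ->; rewrite !inE eqxx ?orbT.
Qed.

(** * Linear maps and tensor products *)

Lemma lspan_relation (A : nzRingType) (M : lmodType A) (S : set M) n
    (g : 'I_n -> A) (u : 'I_n -> M) x :
  qpi S x = \sum_(i < n) g i *: qpi S (u i) ->
  lspan S (x + \sum_(i < n) - g i *: u i).
Proof.
move=> xE; rewrite -[X in lspan S X]subr0; apply/qpi_eq.
rewrite linear0 linearD /= xE linear_sum -big_split big1 // => i _ /=.
by rewrite linearZ /= scaleNr subrr.
Qed.

Section Linear.
Variables (A : nzRingType) (M N : lmodType A) (f : M -> N).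
Hypothesis f_lin : linear f.

Lemma linear_fun0 : f 0 = 0.
Proof. by have := f_lin (-1) 0 0; rewrite scaler0 addr0 scaleN1r addNr. Qed.

(** Modes and projections are bare functions with a separate proof of linearity, hence the
    hypothesis [f_lin] instead of a bundled map. *)
Lemma submodule_preimage U : submodule U -> submodule (f @^-1` U).
Proof.
move=> [U0 UD]; split=> /= [|a x y Ux Uy]; first by rewrite linear_fun0.
by rewrite f_lin; exact: UD.
Qed.

End Linear.

Lemma linear_comp (A : nzRingType) (M N P : lmodType A) (g : N -> P) (f : M -> N) :
  linear g -> linear f -> linear (g \o f).
Proof. by move=> gl fl a x y /=; rewrite fl gl. Qed.

Section Tensor.
Variables (F : fieldType) (A : comAlgType F) (W : lmodType F).

Lemma tens_scale1 (w : W) (a : A) : tens w a = a *: tens w 1.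
Proof. by rewrite tensZ mulr1. Qed.

Variable U : set (tensor A W).
Hypothesis sU : submodule U.

Lemma submodule_tens1 : submodule [set w : W | U (tens w 1)].
Proof.
split=> /= [|c u v Uu Uv].
  by rewrite -(scale0r (0 : W)) tensZl scale0r tens_scale1 scale0r; exact: sU.1.
by rewrite tensDl tensZl tens_scale1; exact: sU.2.
Qed.

Lemma submodule_tensT : (forall w, U (tens w 1)) -> U = setT.
Proof.
move=> U1; apply/seteqP; split=> // x _; apply: (tensor_ind (P := U)) => [w a|y z].
  by rewrite tens_scale1; exact: (submoduleZ _ sU).
exact: (submoduleD sU).
Qed.

(** The first hypothesis has the shape of a torus relation: a leading tensor plus Eisenstein
    corrections, which are subtracted. *)
Lemma submodule_tens_fsum (I : choiceType) (D : set I) (a : A) (f : I -> W)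
    (r : I -> A) x :
  U (tens x 1 + a *: \sum_(i \in D) tens (f i) (r i)) ->
  (forall i, D i -> U (tens (f i) 1)) -> U (tens x 1).
Proof.
move=> Ux Uf; set S := a *: _ in Ux; rewrite -[tens x 1](addrK S).
apply: (submoduleB sU) => //; apply: (submoduleZ _ sU).
apply: (submodule_fsum sU) => i Di; rewrite tens_scale1.
by apply: (submoduleZ _ sU); exact: Uf.
Qed.

Lemma noetherian_tens_relation (S : set (tensor A W)) (u : nat -> W) :
  noetherian_module (quotmod S) -> exists (s : nat) (g : 'I_s -> A),
    lspan S (tens (u s) 1 + \sum_(i < s) g i *: tens (u i) 1).
Proof.
move=> noe; have [s [g sE]] := noetherian_seq (fun i => qpi S (tens (u i) 1)) noe.
by exists s, (fun i => - g i); exact: (lspan_relation sE).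
Qed.

End Tensor.

(** * Direct sum gradings *)

Section Grading.
Variables (C : numFieldType) (M : lmodType C) (pr : nat -> M -> M).
Hypothesis gr : grading_axioms pr.

Lemma homog_proj n x : homog pr n (pr n x).
Proof. by rewrite /homog /= (Defs.proj_ortho gr) eqxx. Qed.

Lemma proj_homog m n x : homog pr m x -> pr n x = if n == m then x else 0.
Proof. by move=> <-; exact: Defs.proj_ortho. Qed.

Lemma submodule_homog (U : set M) : submodule U ->
  (forall n, homog pr n `<=` U) -> U = setT.
Proof.
move=> sU homU; apply/seteqP; split=> // x _; have [N [_ ->]] := proj_sum gr x.
by apply: (submodule_sum sU) => i _; apply: homU; exact: homog_proj.
Qed.

Lemma homog_fin_gen_lt N : (forall n, fin_gen (homog pr n)) ->
  exists s : seq M, forall n, (n < N)%N -> homog pr n `<=` lspan [set` s].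
Proof.
move=> fg; elim: N => [|N [s sP]]; first by exists [::].
have [t tE] := fg N; exists (s ++ t) => n; rewrite ltnS leq_eqVlt => /orP[/eqP->|/sP].
  by rewrite -tE; apply: lspanS => x /= xt; rewrite mem_cat xt orbT.
by move/subset_trans; apply; apply: lspanS => x /= xs; rewrite mem_cat xs.
Qed.

End Grading.

(** * Homogeneous generators of C_2(W), square modes and coinvariants *)

Section Coinvariants.
Variables (K : realType) (V : voa K[i]) (W : admissible_module V).
Local Notation C := (K[i]).
Local Notation Y := (@adm_Y C V W).
Local Notation C2g := (@C2_gen C V W).
Local Notation tgen := (@torus_gen K V W).
Local Notation Vn := (homog (@voa_proj C V)).
Local Notation Wn := (homog (@adm_proj C V W)).

(** The homogeneous generators of C_2(W) of degree [n]: for [a] of weight [k] and [v] of degree [d],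
    [a_(-2) v] has degree [k + 2 - 1 + d]. *)
Definition C2_gen_deg (n : nat) : set W :=
  [set x | exists k d a v, [/\ Vn k a, Wn d v, (k + d).+1 = n & x = Y a (-2) v]].

(** C_2(W) is a graded subspace: by bilinearity it is spanned by products of homogeneous elements,
    and the projection keeps or kills each of these. *)
Lemma proj_C2 n y :
  lspan (C2g) y -> lspan (C2_gen_deg n) (@adm_proj _ _ W n y).
Proof.
have sX := lspan_submodule (C2_gen_deg n).
have prl := proj_linear (adm_grading W) n.
apply: (lspan_sub (submodule_preimage prl sX)) => _ [a [w ->]].
have sa w' := submodule_preimage
  (linear_comp prl (mode_linearl (adm_weak W) (-2) w')) sX.
have sw a' := submodule_preimage
  (linear_comp prl (mode_linearr (adm_weak W) a' (-2))) sX.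
suff H k b d v : Vn k b -> Wn d v ->
    lspan (C2_gen_deg n) (@adm_proj _ _ W n (Y b (-2) v)).
  have Ha v d : Wn d v -> setT `<=`
      ((fun b => adm_proj n (Y b (-2) v)) @^-1` lspan (C2_gen_deg n)).
    move=> dv; rewrite -(submodule_homog (voa_grading V) (sa v)) // => k b kb.
    exact: H kb dv.
  have /seteqP[_ H2] := submodule_homog (adm_grading W) (sw a)
     (fun d v dv => Ha v d dv a I).
  exact: H2.
move=> kb dv; have := adm_degree (-2) kb dv.
have -> : k%:Z - -2 - 1 + d%:Z = (k + d).+1.
  by lia.
move=> /(proj_homog (adm_grading W) n) ->; case: eqP => [nE|_]; last exact: sX.1.
by apply: lspan_gen; exists k, d, b, v.
Qed.

Lemma C2_cofinite_deg : C2_cofinite W ->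
  exists N, forall n, (N <= n)%N -> Wn n `<=` lspan (C2_gen_deg n).
Proof.
move=> [s sE]; pose pr := @adm_proj _ _ W.
have gr : grading_axioms pr := adm_grading W.
(* Finitely many classes span the quotient by C_2(W), so for some [N] every class has a
   representative with no component in degrees [n >= N]. *)
pose T N : set (quotmod (C2g)) :=
  [set x | exists2 y, x = qpi (C2g) y & forall n, (N <= n)%N -> pr n y = 0].
have sT N : submodule (T N).
  split.
    by exists 0 => [|n _]; rewrite ?linear0 // (linear_fun0 (proj_linear gr n)).
  move=> a _ _ [x -> x0] [y -> y0]; exists (a *: x + y); first by rewrite linearP.
  by move=> n Nn; rewrite (proj_linear gr) x0 // y0 // scaler0 addr0.
have [N sN] : exists N, forall x, x \in s -> T N x.
  elim: (s) => [|x r [N rN]]; first by exists 0%N.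
  have [m [m0 _]] := proj_sum gr (repr x).
  exists (maxn m N) => y; rewrite inE => /orP[/eqP->|/rN[z zE z0]].
    exists (repr x); first by rewrite qpiK.
    by move=> n; rewrite geq_max => /andP[mn _]; exact: m0.
  by exists z => // n; rewrite geq_max => /andP[_ Nn]; exact: z0.
exists N => n Nn w nw.
have [y wy y0] : T N (qpi (C2g) w).
  by apply: (lspan_sub (sT N) sN); rewrite sE.
have /(proj_C2 (n := n)) : lspan (C2g) (w - y) by exact/qpi_eq.
(* The component of [w - y] in degree [n] is [w] itself. *)
rewrite -/pr -[w - y]addrC -scaleN1r (proj_linear gr) y0 // scaler0 add0r.
by rewrite (proj_homog gr n nw) eqxx.
Qed.

Lemma mode0l m (w : W) : Y 0 m w = 0.
Proof. exact: (linear_fun0 (mode_linearl (adm_weak W) m w)). Qed.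

Lemma sqmodeE k a m (w : W) : Vn k a -> sqmode a m w = sqmode_homog k a m w.
Proof.
move=> ka; rewrite /sqmode (fsbigTE [fset k]%fset).
  by rewrite big_seq_fset1 (proj_homog (voa_grading V) k ka) eqxx.
move=> i; rewrite inE (proj_homog (voa_grading V) i ka) => /negbTE->.
rewrite /sqmode_homog fsbig1 ?scaler0 // => j _; by rewrite mode0l scaler0.
Qed.

Lemma submodule_sqmode_homog (U : set W) k a m (w : W) : submodule U ->
  (forall j : nat, U (Y a (m + j%:Z) w)) -> U (sqmode_homog k a m w).
Proof.
move=> sU UY; apply: (submoduleZ _ sU); apply: (submodule_fsum sU) => j _.
exact: (submoduleZ _ sU).
Qed.

Lemma twopii_neq0 : twopii K != 0.
Proof.
by rewrite eq_complex /= negb_and mulf_neq0 ?orbT // ?pnatr_eq0 // gt_eqF // pi_gt0.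
Qed.

Lemma fcoef0X (f : fps C) (m : int) : fcoef f 0 = 1 -> fcoef (f ^ m) 0 = 1.
Proof.
have M0 (g h : fps C) : fcoef (g * h) 0 = fcoef g 0 * fcoef h 0.
  by rewrite fcoefM big_ord1.
move=> f0; have X0 n : fcoef (f ^+ n) 0 = 1.
  by elim: n => // n IHn; rewrite exprS M0 f0 IHn mulr1.
case: m => n; first exact: X0.
rewrite NegzE -exprnN.
have u : f ^+ n.+1 \is a GRing.unit by rewrite /in_mem /= /funit X0 oner_eq0.
by have := congr1 (fun g => fcoef g 0) (divrr u); rewrite M0 X0 mul1r.
Qed.

(** The series [flog^m (1 + z)^(k-1)] has constant term 1, so up to the nonzero factor
    [twopii ^ (- m - 1)], [a[m] w] is [a_(m) w] plus a combination of the [a_(m+j) w] with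
    [j >= 1]. *)
Lemma submodule_mode_sqmode (U : set W) k a m (w : W) : submodule U ->
  U (sqmode_homog k a m w) -> (forall j : nat, U (Y a (m + j.+1%:Z) w)) ->
  U (Y a m w).
Proof.
move=> sU Usq UY.
pose F j := fcoef (flog K ^ m * (1 + fvar C) ^ (k%:Z - 1)) j *: Y a (m + j%:Z) w.
have F0 : F 0%N = Y a m w.
  rewrite /F fcoefM big_ord1 !fcoef0X ?mulr1 ?scale1r ?addr0 //.
    by rewrite fcoefD /= addr0.
  by rewrite /= expr0 divr1.
have [N NP] := mode_truncation (adm_weak W) a w.
(* For these [j], [m + j >= N], where truncation applies; the sum is thus genuinely finite. *)
have F_eq0 j : (N + `|m| <= j)%N -> F j = 0.
  move=> Nj; have [i iN iE] : exists2 i : nat, (N <= i)%N & m + j%:Z = i%:Z.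
    by exists (absz (m + j%:Z)); lia.
  by rewrite /F iE NP // scaler0.
have {Usq} : U (\sum_(j \in [set: nat]) F j).
  have := submoduleZ (twopii K ^ (- m - 1))^-1 sU Usq.
  by rewrite scalerA mulVf ?expfz_neq0 ?twopii_neq0 // scale1r.
(* The successor makes the index list nonempty, so that the term of index 0 can be split off. *)
rewrite (fsbigE (iota 0 (N + `|m|).+1)) ?iota_uniq //; last first.
  by move=> j _; rewrite mem_iota add0n /= -leqNgt => /ltnW; exact: F_eq0.
rewrite [iota _ _]/= big_cons in_setT F0; set S := \sum_(_ <- _ | _) _ => Usq.
rewrite -[Y a m w](addrK S); apply: (submoduleB sU) => //.
rewrite /S big_seq_cond; apply: (submodule_sum sU) => -[|j].
  by rewrite mem_iota.
by move=> _; exact: (submoduleZ _ sU).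
Qed.

(** The torus relation for [a[-2] v] involves besides it only [a[2l-2] v] with [l >= 1], built from
    modes [a_(i) v] with [i >= 0], which have degree below [n]. *)
Lemma torus_mode_mem (U : set (WR W)) n : submodule U -> tgen `<=` U ->
  (forall m, (m < n)%N -> Wn m `<=` [set w | U (tens w 1)]) ->
  C2_gen_deg n `<=` [set w | U (tens w 1)].
Proof.
move=> sU gU IH _ [k [d [a [v [ka dv nE ->]]]]].
have sW := submodule_tens1 sU.
(* The degree of [a_(i) v] is [k + d - i - 1 <= k + d], one less than [n] at most; in negative
   degree the vector is 0. *)
have UY i : -1 <= i -> [set w | U (tens w 1)] (Y a i v).
  move=> i_ge; have := adm_degree i ka dv.
  case eE: (_ + _) => [e|e]; last by move=> ->; exact: sW.1.
  by apply: IH; lia.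
have Usq (i : nat) : U (tens (sqmode a i%:Z v) 1).
  rewrite (sqmodeE i v ka); apply: (submodule_sqmode_homog _ sW) => j.
  by apply: UY; lia.
apply: (submodule_mode_sqmode (k := k) sW); last first.
  by move=> j; apply: UY; lia.
rewrite -(sqmodeE _ _ ka) /=.
apply: (submodule_tens_fsum sU).
  by apply: gU; right; exists a, v, 2%N.
move=> l /= l1.
rewrite subzn; last by lia.
exact: Usq.
Qed.

Theorem fin_gen_coinvariants : (forall n, fin_gen (Wn n)) ->
  C2_cofinite W -> fin_gen [set: coinvariants W].
Proof.
move=> Wfin /C2_cofinite_deg[N NP].
have [s sP] := homog_fin_gen_lt N Wfin.
pose q w : coinvariants W := qpi (tgen) (tens w 1).
exists (map q s); apply/seteqP; split=> // x _.
have sS := lspan_submodule [set` map q s].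
pose U := qpi (tgen) @^-1` lspan [set` map q s].
have sU : submodule U by apply: submodule_preimage => // a y z; exact: linearP.
rewrite -[x]qpiK; suff UT : U = setT by have : U (repr x) by rewrite UT.
apply: submodule_tensT => // w; pose P := [set w | U (tens w 1)].
have sP' : submodule P := submodule_tens1 sU.
suff PT : P = setT by have : P w by rewrite PT.
(* Strong induction on the degree: below [N] the chosen generators suffice, and from [N] on every
   vector is a sum of elements [a_(-2) v] of the same degree. *)
apply: (submodule_homog (adm_grading W)) => //; elim/ltn_ind => n IHn.
have [nN|Nn] := ltnP n N.
  apply: subset_trans (sP n nN) _; apply: lspan_sub => // w' w's.
  by apply: lspan_gen; exact: map_f.
apply: subset_trans (NP n Nn) _; apply: lspan_sub => //.
apply: torus_mode_mem => // y gy; rewrite /U /=.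
(* The torus relations vanish in the coinvariants, so they belong to the preimage [U]. *)
have -> : qpi (tgen) y = 0.
  by rewrite -(linear0 (qpi (tgen))); apply/qpi_eq; rewrite subr0; exact: lspan_gen.
exact: sS.1.
Qed.

End Coinvariants.

Theorem proposition4p27 (K : realType) (V : voa K[i]) (W : admissible_module V)
    (h : K[i]) (hirr : irreducible_module W) (hord : ordinary W h)
    (hC2 : C2_cofinite W) :
  fin_gen [set: coinvariants W] /\
  (forall v : W, exists (s : nat) (g : 'I_s -> qmodular K),
     torus_sub W
       (tens (iter s (Lsq W (-2)) v) 1
        + \sum_(i < s) g i *: tens (iter i (Lsq W (-2)) v) 1)).
Proof.
have fg := fin_gen_coinvariants hord.2.2 hC2; split=> // v.
have noe := noetherian_fin_gen (@noetherian_qmodular K) fg.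
exact: (noetherian_tens_relation (fun i => iter i (Lsq W (-2)) v) noe).
Qed.
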